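(* Let $f:\Omega\times\mathbb{R}\to\mathbb{R}$ be a Carathéodory function satisfying the growth condition $$|f(x,t)|\le C(1+|t|^{q-1})\quad\text{for a.e. }x\in\Omega\text{ and all }t\in\mathbb{R},$$ for some $C>0$ and $q\in[1,2_s^*]$. Then every weak solution $u\in X(\Omega)$ of the problem $L_Ku=f(x,u)$ in $\Omega$, $u=0$ in $\mathbb{R}^n\setminus\Omega$, belongs to $L^\infty(\Omega)$. Moreover, if $q<2_s^*$, there exists a function $M\in C(\mathbb{R}_+)$, depending only on $C,n,s,\Omega$ (and the kernel $K$), such that every such weak solution satisfies $\|u\|_{L^\infty(\Omega)}\le M(\|u\|_{L^{2_s^*}(\Omega)})$.
   Context: Standing assumptions: $s\in(0,1)$, $n>2s$, $\Omega\subset\mathbb{R}^n$ is a bounded domain with $C^{1,1}$ boundary, $2_s^*=2n/(n-2s)$. The kernel is $K(y)=a(y/|y|)|y|^{-(n+2s)}$ for $y\neq0$, with $a\in L^1(S^{n-1})$ even and $\inf_{S^{n-1}}a>0$. The space $X(\Omega)=\{u\in L^2(\mathbb{R}^n):\ \int_{\mathbb{R}^{2n}}|u(x)-u(y)|^2K(x-y)\,dx\,dy<\infty,\ u=0\text{ a.e. in }\mathbb{R}^n\setminus\Omega\}$ is a Hilbert space with inner product $\langle u,v\rangle=\int_{\mathbb{R}^{2n}}(u(x)-u(y))(v(x)-v(y))K(x-y)\,dx\,dy$ and norm $\|u\|=\langle u,u\rangle^{1/2}$. A weak solution of $L_Ku=f(x,u)$ in $\Omega$, $u=0$ in $\mathbb{R}^n\setminus\Omega$,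 is $u\in X(\Omega)$ with $\langle u,v\rangle=\int_\Omega f(x,u(x))v(x)\,dx$ for all $v\in X(\Omega)$.
   Formalization: The function M is allowed to depend also on the growth exponent q, which the statement's list ''only on C, n, s, Ω (and the kernel K)'' omits; an M uniform in all q < 2_s^* is impossible, by concentrating bubbles with q close to 2_s^*. *)

(* Defs.v *)
(* Points of R^n are n-tuples of reals
   (n.-tuple R carries the product Borel sigma-algebra in MathComp-Analysis). *)
From HB Require Import structures.
From mathcomp Require Import all_boot all_order all_algebra.
From mathcomp Require Import all_classical all_reals all_analysis.
Set Implicit Arguments. Unset Strict Implicit. Unset Printing Implicit Defensive.
Import Order.TTheory GRing.Theory Num.Theory.
Import numFieldNormedType.Exports.
Local Open Scope classical_set_scope.
Local Open Scope ring_scope.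

Section Defs.
Context {R : realType}.

Definition vadd {n} (x y : n.-tuple R) : n.-tuple R :=
  [tuple tnth x i + tnth y i | i < n].
Definition vsub {n} (x y : n.-tuple R) : n.-tuple R :=
  [tuple tnth x i - tnth y i | i < n].
Definition vscale {n} (c : R) (x : n.-tuple R) : n.-tuple R :=
  [tuple c * tnth x i | i < n].
Definition vneg {n} (x : n.-tuple R) : n.-tuple R := vscale (-1) x.
Definition vzero {n} : n.-tuple R := [tuple 0 | i < n].
Definition vnorm {n} (x : n.-tuple R) : R := Num.sqrt (\sum_(i < n) tnth x i ^+ 2).
Definition vdist {n} (x y : n.-tuple R) : R := vnorm (vsub x y).
Definition ebasis {n} (i : 'I_n) : n.-tuple R := [tuple (i == j)%:R | j < n].
(* x / |x| (and 0 at 0) *)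
Definition vnormalize {n} (x : n.-tuple R) : n.-tuple R := vscale (vnorm x)^-1 x.
Definition vhead {n} (x : n.-tuple R) : R := nth 0 (val x) 0.
Definition vtail {n} (x : n.-tuple R) : n.-1.-tuple R := [tuple of behead x].

(* mu is the n-dimensional Lebesgue measure (on Borel sets): it gives every
   closed box its volume (this determines mu uniquely). *)
Definition is_lebesgue_measure {n} (mu : {measure set (n.-tuple R) -> \bar R}) :=
  forall a b : n.-tuple R, (forall i, tnth a i <= tnth b i) ->
    mu [set x | forall i, tnth a i <= tnth x i <= tnth b i] =
    (\prod_(i < n) (tnth b i - tnth a i))%:E.

Definition open_set {n} (A : set (n.-tuple R)) :=
  forall x, A x -> exists r : R, 0 < r /\ forall y, vdist y x < r -> A y.
Definition connected_set {n} (A : set (n.-tuple R)) :=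
  forall U V : set (n.-tuple R), open_set U -> open_set V ->
    A `<=` U `|` V -> A `&` U `&` V = set0 ->
    A `&` U = set0 \/ A `&` V = set0.
Definition euclid_bounded {n} (A : set (n.-tuple R)) :=
  exists B : R, forall x, A x -> vnorm x <= B.
Definition domain {n} (A : set (n.-tuple R)) :=
  A !=set0 /\ open_set A /\ connected_set A.
Definition boundary_point {n} (A : set (n.-tuple R)) (x0 : n.-tuple R) :=
  forall e : R, 0 < e ->
    (exists y, vdist y x0 < e /\ A y) /\ (exists y, vdist y x0 < e /\ ~ A y).
Definition partial {m} (i : 'I_m) (g : m.-tuple R -> R) (x : m.-tuple R) : R :=
  derive1 (fun t : R => g (vadd x (vscale t (ebasis i)))) 0.
Definition C11 {m} (g : m.-tuple R -> R) :=
  (forall (i : 'I_m) x, derivable (fun t : R => g (vadd x (vscale t (ebasis i)))) 0 1)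
  /\ exists L : R, forall (i : 'I_m) x y,
       `|partial i g x - partial i g y| <= L * vdist x y.
Definition C11_boundary {n} (Om : set (n.-tuple R)) :=
  forall x0, boundary_point Om x0 ->
    exists r : R, 0 < r /\
    exists Phi : n.-tuple R -> n.-tuple R,
      (forall x y, vdist (Phi x) (Phi y) = vdist x y) /\
    exists g : n.-1.-tuple R -> R, C11 g /\
      forall x, vdist x x0 < r -> (Om x <-> g (vtail (Phi x)) < vhead (Phi x)).

(* conditions on a : S^{n-1} -> R (only values on the unit sphere matter):
   even, inf_{S^{n-1}} a > 0, and a in L^1(S^{n-1}).  The surface measure
   sigma on the sphere is the cone measure sigma(E) = n |{r t : 0<r<=1, t in E}|,
   so a in L^1(S^{n-1}) iff x |-> a(x/|x|) is measurable and integrable on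
   the unit ball. *)
Definition kernel_coeff {n} (mu : {measure set (n.-tuple R) -> \bar R})
    (a : n.-tuple R -> R) :=
  (forall th, vnorm th = 1 -> a (vneg th) = a th) /\
  (exists c : R, 0 < c /\ forall th, vnorm th = 1 -> c <= a th) /\
  measurable_fun setT (fun x => a (vnormalize x)) /\
  (\int[mu]_(x in [set x | (vnorm x <= 1)%R]) (`|a (vnormalize x)|)%:E < +oo)%E.

(* K(y) = a(y/|y|) |y|^{-(n+2s)} for y <> 0 (value at 0 irrelevant) *)
Definition kernelK {n} (s : R) (a : n.-tuple R -> R) (y : n.-tuple R) : R :=
  if y == vzero then 0
  else a (vnormalize y) * powR (vnorm y) (- (n%:R + 2 * s)).

Definition inX {n} (mu : {measure set (n.-tuple R) -> \bar R})
    (K : n.-tuple R -> R) (Om : set (n.-tuple R)) (u : n.-tuple R -> R) :=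
  measurable_fun setT u /\
  (\int[mu]_x ((u x) ^+ 2)%R%:E < +oo)%E /\
  (\int[mu]_x \int[mu]_y (((u x - u y) ^+ 2) * K (vsub x y))%R%:E < +oo)%E /\
  {ae mu, forall x, ~ Om x -> u x = 0}.

Definition formK {n} (mu : {measure set (n.-tuple R) -> \bar R})
    (K : n.-tuple R -> R) (u v : n.-tuple R -> R) : \bar R :=
  (\int[mu]_x \int[mu]_y ((u x - u y) * (v x - v y) * K (vsub x y))%R%:E)%E.

Definition weak_solution {n} (mu : {measure set (n.-tuple R) -> \bar R})
    (K : n.-tuple R -> R) (Om : set (n.-tuple R))
    (f : n.-tuple R -> R -> R) (u : n.-tuple R -> R) :=
  inX mu K Om u /\
  forall v, inX mu K Om v ->
    formK mu K u v = (\int[mu]_(x in Om) (f x (u x) * v x)%R%:E)%E.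

Definition caratheodory {n} (mu : {measure set (n.-tuple R) -> \bar R})
    (Om : set (n.-tuple R)) (f : n.-tuple R -> R -> R) :=
  (forall t, measurable_fun Om (fun x => f x t)) /\
  {ae mu, forall x, Om x -> continuous (fun t : R => f x t)}.

Definition growth {n} (mu : {measure set (n.-tuple R) -> \bar R})
    (Om : set (n.-tuple R)) (f : n.-tuple R -> R -> R) (C q : R) :=
  {ae mu, forall x, Om x -> forall t, `|f x t| <= C * (1 + powR `|t| (q - 1))}.

Definition in_Linfty {n} (mu : {measure set (n.-tuple R) -> \bar R})
    (Om : set (n.-tuple R)) (u : n.-tuple R -> R) :=
  exists B : R, {ae mu, forall x, Om x -> `|u x| <= B}.

Definition Lp_norm {n} (mu : {measure set (n.-tuple R) -> \bar R})
    (Om : set (n.-tuple R)) (p : R) (u : n.-tuple R -> R) : R :=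
  powR (fine (\int[mu]_(x in Om) (powR `|u x| p)%R%:E)%E) p^-1.

Definition crit_exp (n : nat) (s : R) : R := 2 * n%:R / (n%:R - 2 * s).

End Defs.

(* Main.v *)
(* De Giorgi iteration on the truncations w_k = (+-u - k)^+, which are admissible
   test functions.  The lower bound c |y|^-(n+2s) <= K y gives, for w >= 0 and
   p = 2n/(n-2s), a pointwise Sobolev inequality: with I the integral of w^p,
     S I^(-2s/n) w(x)^p <= int (w x - w y)^2 K(x - y) dy,
   because on a cube around x of volume comparable to I / w(x)^p the function w
   is mostly below w(x)/2.  Integrating in x bounds S I^(1 - 2s/n) by the energy of
   w, so testing the equation with w_k controls the mass Y_k of w_k^p by a
   power greater than 1 of Y_h for h < k, with a factor k0^(q-p) when h >= k0.
   Along the levels k0 (2 - 2^-j) the masses tend to 0 once Y_k0 is small: when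
   q = p this holds for k0 large depending on u, and when q < p the
   factor k0^(q-p) makes a level polynomial in the L^p norm sufficient. *)
Require Import Defs.
From HB Require Import structures.
From mathcomp Require Import all_boot all_order all_algebra.
From mathcomp Require Import all_classical all_reals all_analysis.
From mathcomp Require Import measurable_realfun simple_functions.
From mathcomp Require Import ring lra.
Set Implicit Arguments. Unset Strict Implicit. Unset Printing Implicit Defensive.
Import Order.TTheory GRing.Theory Num.Theory.
Import numFieldNormedType.Exports.
Local Open Scope classical_set_scope.
Local Open Scope ring_scope.

(** * Monotonicity of the integral *)

Section integral_monotonicity.
Local Open Scope ereal_scope.
Context d (T : measurableType d) (R : realType) (mu : {measure set T -> \bar R}).
Import HBNNSimple.

(* The integral of a nonnegative function is a supremum over simple functions
   below it, so monotonicity needs no measurability. *)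
Lemma ae_le_integral (f g : T -> \bar R) : (forall x, 0 <= g x) ->
  {ae mu, forall x, f x <= g x} -> \int[mu]_x f x <= \int[mu]_x g x.
Proof.
move=> g0 [N [mN N0 fgN]].
have fpos0 x : 0 <= f^\+ x by rewrite funeposE le_max lexx orbT.
have fneg0 x : 0 <= f^\- x by rewrite funenegE le_max lexx orbT.
(* [f] may change sign; discarding its negative part only increases the integral. *)
rewrite integralE; apply: (@le_trans _ _ (\int[mu]_x f^\+ x)).
  by rewrite -[leRHS]sube0 leeB// integral_ge0.
rewrite !ge0_integralTE//; apply: ge_ereal_sup => _ [h hf <-].
(* Cutting [h] off on the null set [N] puts it below [g] everywhere and leaves its integral
   unchanged. *)
apply: ereal_sup_ubound; exists (proj_nnsfun h (measurableC mN)).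
  move=> x /=; rewrite mindicE.
  case: (boolP (x \in ~` N)) => xN; last by rewrite mulr0.
  rewrite mulr1; apply: (le_trans (hf x)).
  have : f x <= g x.
    by apply: contrapT => nfg; have := set_mem xN; apply; apply: fgN.
  by move=> fg; rewrite funeposE ge_max fg g0.
rewrite -!integralT_nnsfun; apply: ae_eq_integral => //.
- exact/measurable_EFinP.
- exact/measurable_EFinP.
exists N; split=> // x /= nh; apply: contrapT => xN; apply: nh => _ /=.
by rewrite mindicE mem_set// mulr1.
Qed.

Lemma le_integral_pointwise (f g : T -> \bar R) : (forall x, 0 <= g x) ->
  (forall x, f x <= g x) -> \int[mu]_x f x <= \int[mu]_x g x.
Proof. by move=> g0 fg; apply: ae_le_integral => //; apply: aeW. Qed.

End integral_monotonicity.

(** * Cubes and the Euclidean norm *)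

Section cube.
Context {R : realType} {n : nat}.
Implicit Types (x y : n.-tuple R) (h r : R).

Definition cube x h : set (n.-tuple R) :=
  [set y | forall i, tnth x i - h <= tnth y i <= tnth x i + h].

Lemma measurable_cube x h : measurable (cube x h).
Proof.
have -> : cube x h = \bigcap_(i in [set: 'I_n])
    ((fun y => tnth y i) @^-1` `[tnth x i - h, tnth x i + h]).
  apply/seteqP; split => y /= yQ i; first by move=> _ /=; rewrite in_itv /=; exact: yQ.
  by have := yQ i I; rewrite /= in_itv.
apply: fin_bigcap_measurable; first exact: finite_finset.
move=> i _; rewrite -[X in measurable X]setTI.
exact: (measurable_tnth i).
Qed.

Lemma lebesgue_measure_cube (mu : {measure set (n.-tuple R) -> \bar R}) x h :
  is_lebesgue_measure mu -> 0 <= h -> mu (cube x h) = ((2 * h) ^+ n)%:E.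
Proof.
move=> leb h0.
have := leb [tuple tnth x i - h | i < n] [tuple tnth x i + h | i < n].
have -> : [set y | forall i, tnth [tuple tnth x i - h | i < n] i <= tnth y i
                         <= tnth [tuple tnth x i + h | i < n] i] = cube x h.
  by apply/seteqP; split => y /= yQ i; have := yQ i; rewrite !tnth_mktuple.
move=> -> => [|i]; last by rewrite !tnth_mktuple; lra.
congr (_%:E); rewrite (eq_bigr (fun=> 2 * h)).
  by rewrite prodr_const card_ord.
by move=> i _; rewrite !tnth_mktuple; ring.
Qed.

Lemma vnorm_cube x h y : 0 <= h -> cube x h y ->
  vnorm (vsub x y) <= Num.sqrt n%:R * h.
Proof.
move=> h0 yQ; rewrite -[X in _ * X]ger0_norm// -sqrtr_sqr.
rewrite -sqrtrM// /vnorm ler_wsqrtr//.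
apply: (@le_trans _ _ (\sum_(i < n) h ^+ 2)).
  apply: ler_sum => i _; rewrite tnth_mktuple -real_normK ?num_real//.
  rewrite ler_sqr ?nnegrE//.
  by have /andP[a b] := yQ i; rewrite ler_norml; lra.
by rewrite sumr_const card_ord mulr_natl.
Qed.

Lemma vnorm_eq0 y : vnorm y = 0 -> y = vzero.
Proof.
move=> /eqP; rewrite /vnorm sqrtr_eq0 => y0.
apply: eq_from_tnth => i; rewrite tnth_mktuple; apply/eqP.
rewrite -sqrf_eq0 eq_le sqr_ge0 andbT (le_trans _ y0)//.
by rewrite (bigD1 i)//= lerDl sumr_ge0// => j _; exact: sqr_ge0.
Qed.

Lemma vnorm_ge0 y : 0 <= vnorm y. Proof. exact: sqrtr_ge0. Qed.

Lemma vnorm_normalize y : y <> vzero -> vnorm (vnormalize y) = 1.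
Proof.
move=> y0; have ny : vnorm y != 0 by apply/eqP => /vnorm_eq0.
rewrite /vnorm /vnormalize (eq_bigr (fun i => (vnorm y)^-1 ^+ 2 * tnth y i ^+ 2)).
  rewrite -mulr_sumr sqrtrM ?sqr_ge0// sqrtr_sqr ger0_norm ?invr_ge0 ?vnorm_ge0//.
  exact: mulVf.
by move=> i _; rewrite tnth_mktuple exprMn.
Qed.

Lemma vsub_eq0 x y : vsub x y = vzero -> x = y.
Proof.
move=> xy; apply: eq_from_tnth => i; apply/eqP; rewrite -subr_eq0.
by have := congr1 (fun z => tnth z i) xy; rewrite !tnth_mktuple => ->.
Qed.

End cube.

(** * Arithmetic of the critical exponent *)

Section critical_exponent.
Context {R : realType} (n : nat) (s : R).
Hypotheses (s0 : 0 < s) (sn : 2 * s < n%:R).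
Notation p := (crit_exp n s).

Lemma dimension_gt0 : 0 < n%:R :> R.
Proof. by move: s0 sn => ? ?; lra. Qed.

Lemma crit_exp_gt2 : 2 < p.
Proof. by move: s0 sn => ? ?; rewrite /crit_exp ltr_pdivlMr; lra. Qed.

(** Merges the factor t^2 of the squared deviation with the power of t in the cube volume into
    t^p. *)
Lemma crit_exp_sobolev : 2 + p * (2 * s / n%:R) = p.
Proof. by move: s0 sn => ? ?; rewrite /crit_exp; field; rewrite !lt0r_neq0//; lra. Qed.

(** Raising to the power [p / 2] undoes the Sobolev exponent; as [p / 2 > 1], this is the
    superlinear gain of the iteration. *)
Lemma crit_exp_half : (1 - 2 * s / n%:R) * (p / 2) = 1.
Proof. by move: s0 sn => ? ?; rewrite /crit_exp; field; rewrite !lt0r_neq0//; lra. Qed.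

End critical_exponent.

(** * The pointwise Sobolev inequality *)

Section fractional_sobolev.
Context {R : realType} (n : nat) (s : R).
Variables (mu : {measure set (n.-tuple R) -> \bar R}) (K : n.-tuple R -> R) (c : R).
Hypotheses (s0 : 0 < s) (sn : 2 * s < n%:R) (leb : is_lebesgue_measure mu).
Hypotheses (c0 : 0 < c) (K0 : forall y, 0 <= K y).
Hypothesis Kc : forall y, y <> vzero -> c * vnorm y `^ (- (n%:R + 2 * s)) <= K y.
Notation p := (crit_exp n s).
Implicit Types (t I h : R) (x y : n.-tuple R) (u v w : n.-tuple R -> R).

(** The squared norm of X, with extended real values so that it can be compared before it is known
    to be finite. *)
Definition energy w : \bar R :=
  (\int[mu]_x \int[mu]_y ((w x - w y) ^+ 2 * K (vsub x y))%:E)%E.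

Definition powint w : \bar R := (\int[mu]_x (`|w x| `^ p)%:E)%E.

Lemma measurable_powint w : measurable_fun setT w ->
  measurable_fun setT (fun x => (`|w x| `^ p)%:E).
Proof.
move=> mw; apply/measurable_EFinP.
apply: (measurableT_comp (measurable_powR p)).
exact: (measurableT_comp (@normr_measurable _ _)).
Qed.

(* Either [w y] is below half of [t], and then [(t - w y) ^+ 2] is large, or
   [w y] carries a definite share of the integral; on a cube whose volume is
   large compared with the integral the first case prevails. *)
Lemma cube_deviation w t I x h : measurable_fun setT w -> (forall y, 0 <= w y) ->
  powint w = I%:E -> 0 < t -> 0 <= h -> (2 * h) ^+ n = 2 * (2 / t) `^ p * I ->
  ((t ^+ 2 * (2 * h) ^+ n / 8)%:E <= \int[mu]_(y in cube x h) ((t - w y) ^+ 2)%:E)%E.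
Proof.
move=> mw w0 wI t0 h0 V; set J := (\int[mu]_(y in _) _)%E.
have mQ := measurable_cube x h.
have mdev : measurable_fun (cube x h) (fun y => ((t - w y) ^+ 2)%:E).
  apply/measurable_EFinP; apply: measurable_funTS.
  by apply: measurable_funX; exact: measurable_funB.
have mpow : measurable_fun (cube x h) (fun y => (`|w y| `^ p)%:E).
  by apply: measurable_funTS; exact: measurable_powint.
have split1 : (((2 * h) ^+ n)%:E <= (4 / t ^+ 2)%:E * J + ((2 / t) `^ p)%:E * I%:E)%E.
  rewrite -(lebesgue_measure_cube x leb h0) -[leLHS]mul1e -[leLHS](integral_cst _ mQ).
  apply: (@le_trans _ _ (\int[mu]_(y in cube x h)
     ((4 / t ^+ 2)%:E * ((t - w y) ^+ 2)%:E + ((2 / t) `^ p)%:E * (`|w y| `^ p)%:E)%E)%E).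
    apply: ge0_le_integral => //.
      by apply: emeasurable_funD; exact: measurable_funeM.
    move=> y _ /=; rewrite -!EFinM -EFinD lee_fin.
    have p1 : 0 <= 4 / t ^+ 2 * (t - w y) ^+ 2.
      by rewrite mulr_ge0 ?sqr_ge0// divr_ge0 ?sqr_ge0.
    have p2 : 0 <= (2 / t) `^ p * `|w y| `^ p by rewrite mulr_ge0 ?powR_ge0.
    have [wt|wt] := leP t (2 * w y).
      apply: (@le_trans _ _ ((2 / t) `^ p * `|w y| `^ p)); last lra.
      rewrite -powRM ?divr_ge0 ?(ltW t0)// ger0_norm//.
      rewrite [leLHS](_ : 1 = 1 `^ p); last by rewrite powR1.
      apply: ge0_ler_powR; rewrite ?nnegrE//; last 2 first.
      - by rewrite mulr_ge0// divr_ge0// ltW.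
      - by rewrite mulrAC ler_pdivlMr// mul1r.
      by have := crit_exp_gt2 s0 sn; lra.
    apply: (@le_trans _ _ (4 / t ^+ 2 * (t - w y) ^+ 2)); last lra.
    rewrite mulrAC ler_pdivlMr ?exprn_gt0// mul1r.
    have := w0 y; nra.
  rewrite ge0_integralD//=; last 4 first.
  - by move=> y _; rewrite -EFinM lee_fin mulr_ge0 ?sqr_ge0// divr_ge0 ?sqr_ge0.
  - exact: measurable_funeM.
  - by move=> y _; rewrite -EFinM lee_fin mulr_ge0 ?powR_ge0.
  - exact: measurable_funeM.
  have dev0 y : cube x h y -> (0 <= ((t - w y) ^+ 2)%:E)%E by rewrite lee_fin sqr_ge0.
  have pow0 y : cube x h y -> (0 <= (`|w y| `^ p)%:E)%E by rewrite lee_fin powR_ge0.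
  rewrite !ge0_integralZl_EFin ?powR_ge0 ?divr_ge0 ?sqr_ge0//=.
  rewrite leeD2l// lee_pmul2l ?lte_fin ?powR_gt0 ?divr_gt0//.
  rewrite -wI integral_mkcond; apply: le_integral_pointwise => y.
    by rewrite lee_fin powR_ge0.
  by rewrite patchE; case: ifP => // _; rewrite lee_fin powR_ge0.
have J0 : (0 <= J)%E by apply: integral_ge0 => y _; rewrite lee_fin sqr_ge0.
move: split1 J0; case: J => [j| |]//; last by move=> _ _; exact: leey.
rewrite -!EFinM -EFinD !lee_fin => le_V j0.
have t2 : 0 < t ^+ 2 by rewrite exprn_gt0.
(* By the choice of the volume in [V], the term with the integral of w^p accounts for exactly half
   of it. *)
have : (2 * h) ^+ n / 2 <= 4 / t ^+ 2 * j by lra.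
rewrite mulrAC ler_pdivlMr// => ?; lra.
Qed.

(** [c / 8] joins the kernel bound to [cube_deviation]; the next factor comes from the
    centre-to-corner distance of a cube, and the powers of 2 from its volume 2 (2/t)^p I raised to
    the power -2s/n. *)
Definition sobolev_const : R := c / 8 * (Num.sqrt n%:R / 2) `^ (- (n%:R + 2 * s)) *
  2 `^ (- (2 * s / n%:R)) * 2 `^ (- (p * (2 * s / n%:R))).

Lemma sobolev_const_gt0 : 0 < sobolev_const.
Proof.
have n0 := dimension_gt0 s0 sn.
by rewrite /sobolev_const !mulr_gt0 ?powR_gt0 ?divr_gt0 ?sqrtr_gt0.
Qed.

(** Restrict the inner integral to the cube of [cube_deviation] centred at x: there K is at least a
    constant times V^(-1 - 2s/n), while the squared deviation integrates to at least t^2 V / 8. *)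
Lemma pointwise_sobolev w I x : measurable_fun setT w -> (forall y, 0 <= w y) ->
  powint w = I%:E -> 0 < I ->
  ((sobolev_const * I `^ (- (2 * s / n%:R)) * w x `^ p)%:E <=
   \int[mu]_y ((w x - w y) ^+ 2 * K (vsub x y))%:E)%E.
Proof.
move=> mw w0 wI I0; have n0 := dimension_gt0 s0 sn.
have D0 y : (0 <= ((w x - w y) ^+ 2 * K (vsub x y))%:E)%E.
  by rewrite lee_fin mulr_ge0 ?sqr_ge0.
have := w0 x; rewrite le_eqVlt => /predU1P[/esym wx|].
  rewrite [X in X%:E](_ : _ = 0); first by apply: integral_ge0.
  by rewrite wx powR0 ?mulr0// lt0r_neq0//; have := crit_exp_gt2 s0 sn; lra.
set t := w x => t0; pose V := 2 * (2 / t) `^ p * I.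
have V0 : 0 < V by rewrite /V !mulr_gt0 ?powR_gt0 ?divr_gt0.
pose h := V `^ n%:R^-1 / 2.
have h0 : 0 < h by rewrite divr_gt0 ?powR_gt0.
have hV : (2 * h) ^+ n = V.
  rewrite /h mulrC divfK ?pnatr_eq0// -powR_mulrn ?powR_ge0// -powRrM mulVf ?gt_eqF//.
  by rewrite powRr1 ?ltW.
have := cube_deviation x mw w0 wI t0 (ltW h0) hV; rewrite hV.
set J := (\int[mu]_(y in _) _)%E => VJ.
pose k := c * (Num.sqrt n%:R * h) `^ (- (n%:R + 2 * s)).
have r0 : 0 < Num.sqrt n%:R * h by apply: mulr_gt0 => //; rewrite sqrtr_gt0.
have k0 : 0 < k by apply: mulr_gt0 => //; exact: powR_gt0.
have mQ := measurable_cube x h.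
have dev0 y : cube x h y -> (0 <= ((t - w y) ^+ 2)%:E)%E by rewrite lee_fin sqr_ge0.
have mdev : measurable_fun (cube x h) (fun y => ((t - w y) ^+ 2)%:E).
  apply/measurable_EFinP; apply: measurable_funTS.
  by apply: measurable_funX; exact: measurable_funB.
apply: (@le_trans _ _ (k%:E * J)%E); last first.
  rewrite /J -ge0_integralZl_EFin ?(ltW k0)//=.
  rewrite integral_mkcond; apply: le_integral_pointwise => // y.
  rewrite patchE; case: ifP => [/set_mem yQ|_]; last exact: D0.
  rewrite -EFinM lee_fin mulrC.
  (* [Kc] says nothing at y = x, but there the deviation is zero. *)
  have [xy|xy] := pselect (vsub x y = vzero).
    by rewrite -(vsub_eq0 xy) -/t subrr expr0n/= !mul0r.
  rewrite ler_wpM2l ?sqr_ge0//; apply: (le_trans _ (Kc xy)).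
  rewrite ler_wpM2l ?(ltW c0)// !powRN lef_pV2 ?posrE; last 2 first.
  - exact: powR_gt0.
  - rewrite powR_gt0// lt_neqAle vnorm_ge0 andbT eq_sym; apply/eqP.
    by move/vnorm_eq0.
  apply: ge0_ler_powR; rewrite ?nnegrE ?vnorm_ge0//.
  - by rewrite addr_ge0 ?mulr_ge0 ?(ltW s0).
  - exact: ltW.
  - exact: vnorm_cube (ltW h0) yQ.
apply: (@le_trans _ _ (k%:E * (t ^+ 2 * V / 8)%:E)%E); last first.
  by rewrite lee_pmul2l.
rewrite -EFinM lee_fin le_eqVlt; apply/predU1P; left.
(* Since [h] is half the n-th root of [V], the exponent of [V] is -(n + 2s)/n = -2s/n - 1. *)
have -> : k = c * ((Num.sqrt n%:R / 2) `^ (- (n%:R + 2 * s)) *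
    (V `^ (- (2 * s / n%:R)) / V)).
  rewrite /k /h [_ * (_ / 2)](_ : _ = Num.sqrt n%:R / 2 * V `^ n%:R^-1); last by ring.
  rewrite powRM ?powR_ge0 ?divr_ge0 ?sqrtr_ge0// -powRrM; congr (_ * (_ * _)).
  rewrite -[V^-1](powR_inv1 (ltW V0)) -powRD ?(gt_eqF V0) ?implybT//.
  by congr (_ `^ _); field; rewrite lt0r_neq0.
have -> : V `^ (- (2 * s / n%:R)) = 2 `^ (- (2 * s / n%:R)) *
   2 `^ (- (p * (2 * s / n%:R))) * t `^ (p * (2 * s / n%:R)) * I `^ (- (2 * s / n%:R)).
  rewrite /V powRM ?mulr_ge0 ?powR_ge0 ?(ltW I0)// powRM ?powR_ge0// -powRrM.
  rewrite powRM ?invr_ge0 ?(ltW t0)// -(powR_inv1 (ltW t0)) -powRrM.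
  have -> : -1 * (p * - (2 * s / n%:R)) = p * (2 * s / n%:R) by ring.
  have -> : p * - (2 * s / n%:R) = - (p * (2 * s / n%:R)) by ring.
  by rewrite !mulrA.
rewrite -[in LHS](crit_exp_sobolev s0 sn) powRD ?(gt_eqF t0) ?implybT//.
rewrite powR_mulrn ?(ltW t0)// /sobolev_const.
by field; rewrite lt0r_neq0.
Qed.

End fractional_sobolev.

(** * The integrated Sobolev inequality and finiteness of the critical norm *)

Section sobolev_space.
Context {R : realType} (n : nat) (s : R).
Variables (mu : {measure set (n.-tuple R) -> \bar R}) (K : n.-tuple R -> R) (c : R).
Hypotheses (s0 : 0 < s) (sn : 2 * s < n%:R) (leb : is_lebesgue_measure mu).
Hypotheses (c0 : 0 < c) (K0 : forall y, 0 <= K y).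
Hypothesis Kc : forall y, y <> vzero -> c * vnorm y `^ (- (n%:R + 2 * s)) <= K y.
Notation p := (crit_exp n s).
Notation S := (sobolev_const n s c).
Implicit Types (I : R) (x y : n.-tuple R) (u v w : n.-tuple R -> R).

Lemma powint_ge0 w : (0 <= powint s mu w)%E.
Proof. by apply: integral_ge0 => x _; rewrite lee_fin powR_ge0. Qed.

Lemma energy_ge0 w : (0 <= energy mu K w)%E.
Proof.
apply: integral_ge0 => x _; apply: integral_ge0 => y _.
by rewrite lee_fin mulr_ge0 ?sqr_ge0.
Qed.

Lemma le_powint v w : (forall x, `|v x| <= `|w x|) -> (powint s mu v <= powint s mu w)%E.
Proof.
move=> vw; apply: le_integral_pointwise => x; first by rewrite lee_fin powR_ge0.
rewrite lee_fin; apply: ge0_ler_powR; rewrite ?nnegrE//.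
by rewrite (le_trans _ (ltW (crit_exp_gt2 s0 sn))).
Qed.

Lemma le_energy v w : (forall x y, `|v x - v y| <= `|w x - w y|) ->
  (energy mu K v <= energy mu K w)%E.
Proof.
move=> vw.
have w0 x y : (0 <= ((w x - w y) ^+ 2 * K (vsub x y))%:E)%E.
  by rewrite lee_fin mulr_ge0 ?sqr_ge0.
apply: le_integral_pointwise => x; first exact: integral_ge0.
apply: le_integral_pointwise => // y; rewrite lee_fin ler_wpM2r//.
by rewrite -[leLHS]real_normK ?num_real// -[leRHS]real_normK ?num_real// ler_sqr ?nnegrE.
Qed.

(** Integrating the pointwise inequality in x contributes one more factor [I]. The mass is finite
    here by assumption; [powint_lty] establishes this for elements of X. *)
Lemma sobolev w I : measurable_fun setT w -> (forall x, 0 <= w x) ->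
  powint s mu w = I%:E -> ((S * I `^ (1 - 2 * s / n%:R))%:E <= energy mu K w)%E.
Proof.
move=> mw w0 wI.
have D0 x y : (0 <= ((w x - w y) ^+ 2 * K (vsub x y))%:E)%E.
  by rewrite lee_fin mulr_ge0 ?sqr_ge0.
have S0 := sobolev_const_gt0 s0 sn c0.
have := powint_ge0 w; rewrite wI lee_fin le_eqVlt => /predU1P[<-|I0].
  (* Zero to the power zero would be 1, so the exponent has to be shown nonzero. *)
  rewrite powR0 ?mulr0; first by apply: integral_ge0 => x _; exact: integral_ge0.
  by apply/eqP => e0; have := crit_exp_half s0 sn; rewrite e0 mul0r; lra.
apply: (@le_trans _ _ (\int[mu]_x ((S * I `^ (- (2 * s / n%:R)))%:E * (`|w x| `^ p)%:E)%E)%E).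
  have mwp := measurable_powint s mw.
  have wp0 x : [set: n.-tuple R] x -> (0 <= (`|w x| `^ p)%:E)%E.
    by rewrite lee_fin powR_ge0.
  have k0 : 0 <= S * I `^ (- (2 * s / n%:R)) := mulr_ge0 (ltW S0) (powR_ge0 _ _).
  rewrite ge0_integralZl_EFin//=.
  rewrite -/(powint s mu w) wI -EFinM lee_fin -[leRHS]mulrA ler_wpM2l ?(ltW S0)//.
  by rewrite powRD ?(gt_eqF I0) ?implybT// powRr1 ?(ltW I0)// mulrC.
rewrite /energy; apply: le_integral_pointwise => x; first exact: integral_ge0.
by rewrite -EFinM ger0_norm//; exact: pointwise_sobolev.
Qed.

(** [sobolev] cannot be applied to u directly, so |u| is capped at height m. The cap has finite
    mass, because its p-th power is at most m^(p-2) u^2, and no more energy than u; the resulting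
    bound is uniform in m and passes to the limit by monotone convergence. *)
Lemma powint_lty u : measurable_fun setT u ->
  (\int[mu]_x ((u x) ^+ 2)%:E < +oo)%E -> (energy mu K u < +oo)%E -> (powint s mu u < +oo)%E.
Proof.
move=> mu_u u2 Eu; have p2 := crit_exp_gt2 s0 sn.
have S0 := sobolev_const_gt0 s0 sn c0.
have half := crit_exp_half s0 sn.
pose w (m : nat) x := Num.min `|u x| m%:R.
have mw m : measurable_fun setT (w m).
  apply: measurable_minr => //.
  exact: (measurableT_comp (@normr_measurable _ _)).
have w0 m x : 0 <= w m x by rewrite le_min normr_ge0 ler0n.
have wfin m : (powint s mu (w m) < +oo)%E.
  apply: (@le_lt_trans _ _ (\int[mu]_x ((m%:R `^ (p - 2))%:E * ((u x) ^+ 2)%:E)%E)%E).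
    apply: le_integral_pointwise => x.
      by rewrite -EFinM lee_fin mulr_ge0 ?powR_ge0 ?sqr_ge0.
    rewrite -EFinM lee_fin ger0_norm// -[in leLHS](subrK 2 p).
    rewrite [leLHS]powRD; last by rewrite subrK gt_eqF//; lra.
    rewrite powR_mulrn// -[(u x) ^+ 2]real_normK ?num_real//.
    apply: ler_pM; rewrite ?powR_ge0 ?sqr_ge0//; last first.
      by rewrite ler_sqr ?nnegrE// ge_min lexx.
    by apply: ge0_ler_powR; rewrite ?nnegrE ?ge_min ?lexx ?orbT//; lra.
  rewrite ge0_integralZl_EFin ?powR_ge0//=.
  - rewrite lte_mul_pinfty ?lee_fin ?powR_ge0//.
  - by move=> x _; rewrite lee_fin sqr_ge0.
  - by apply/measurable_EFinP; exact: measurable_funX.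
have Ew m : (energy mu K (w m) <= energy mu K u)%E.
  apply: le_energy => x y; apply: (@le_trans _ _ `| `|u x| - `|u y| |).
    rewrite /w ler_norml !minEle; case: (leP `|u x|); case: (leP `|u y|);
      by move=> ? ?; case: (ler0P (`|u x| - `|u y|)); lra.
  exact: ler_dist_dist.
have Eu_fin : energy mu K u \is a fin_num by rewrite ge0_fin_numE ?energy_ge0.
have Eu0 : 0 <= fine (energy mu K u) by rewrite fine_ge0 ?energy_ge0.
pose B := (fine (energy mu K u) / S) `^ (p / 2).
have wB m : (powint s mu (w m) <= B%:E)%E.
  have wm_fin : powint s mu (w m) \is a fin_num by rewrite ge0_fin_numE ?powint_ge0.
  have wm_ge0 : 0 <= fine (powint s mu (w m)) by rewrite fine_ge0 ?powint_ge0.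
  rewrite -(fineK wm_fin) lee_fin.
  have := le_trans (sobolev (mw m) (w0 m) (esym (fineK wm_fin))) (Ew m).
  rewrite -(fineK Eu_fin) lee_fin mulrC -ler_pdivlMr// => le_root.
  rewrite -[leLHS](powRr1 wm_ge0) -half powRrM.
  apply: ge0_ler_powR; rewrite ?nnegrE ?powR_ge0//; first lra.
  by rewrite divr_ge0// ltW.
apply: (@le_lt_trans _ _ B%:E); last exact: ltry.
rewrite /powint.
have -> : (fun x => (`|u x| `^ p)%:E) = (fun x => limn (fun m => (`|w m x| `^ p)%:E)).
  apply/funext => x; apply/esym/cvg_lim => //; apply: cvg_near_cst.
  near=> m; rewrite /w min_l ?normr_id//.
  near: m; exact: nbhs_infty_ger.
have w_nd i j x : (i <= j)%N -> w i x <= w j x.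
  by move=> ij; rewrite /w le_min !ge_min lexx ler_nat ij orbT.
rewrite monotone_convergence//=.
- apply: lime_le; last by apply: nearW => m; exact: wB.
  apply: ereal_nondecreasing_is_cvgn => i j ij; apply: le_powint => x.
  by rewrite !ger0_norm// w_nd.
- by move=> m; exact: measurable_powint.
- move=> x _ i j ij; rewrite lee_fin; apply: ge0_ler_powR; rewrite ?nnegrE//; first lra.
  by rewrite !ger0_norm// w_nd.
Unshelve. all: by end_near.
Qed.

End sobolev_space.

(** * Truncations above a level *)

Section truncation.
Context {R : realType} {T : Type}.
Implicit Types (e k h : R) (u : T -> R).

(** The sign [e] is 1 or -1, so that one argument bounds u from above and from below. *)
Definition truncation e k u : T -> R := fun x => Num.max (e * u x - k) 0.

Lemma truncation_ge0 e k u x : 0 <= truncation e k u x.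
Proof. by rewrite le_max lexx orbT. Qed.

Lemma truncation_le e k h u x : k <= h -> truncation e h u x <= truncation e k u x.
Proof.
by move=> kh; rewrite /truncation ge_max !le_max lexx orbT andbT lerD2l lerN2 kh.
Qed.

Lemma truncation_dist e k u x y : `|e| = 1 ->
  `|truncation e k u x - truncation e k u y| <= `|u x - u y|.
Proof.
move=> e1; rewrite -[leRHS]mul1r -e1 -normrM mulrBr /truncation.
set a := e * u x; set b := e * u y; rewrite !maxEle.
by case: (leP (a - k)); case: (leP (b - k)) => ? ?;
  case: (ler0P (a - b)) => ?; rewrite ler_norml; lra.
Qed.

Lemma truncation_norm e k u x : `|e| = 1 -> 0 <= k -> truncation e k u x <= `|u x|.
Proof.
move=> e1 k0; rewrite ge_max normr_ge0 andbT -[leRHS]mul1r -e1 -normrM.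
by rewrite lerBlDr (le_trans (ler_norm _))// lerDl.
Qed.

(** The map t -> (t - k)^+ is nondecreasing and 1-Lipschitz, so its increment squared is at most its
    increment times that of t. *)
Lemma truncation_form e k u x y : `|e| = 1 ->
  (truncation e k u x - truncation e k u y) ^+ 2 <=
  (u x - u y) * (e * truncation e k u x - e * truncation e k u y).
Proof.
move=> e1; rewrite -mulrBr mulrA [_ * e]mulrC [e * _]mulrBr expr2 /truncation.
set a := e * u x; set b := e * u y; rewrite !maxEle.
case: (leP (a - k)) => ak; case: (leP (b - k)) => bk.
- by rewrite !subrr !mulr0.
- have : 0 <= (k - a) * (b - k) by apply: mulr_ge0; lra.
  by nra.
- have : 0 <= (a - k) * (k - b) by apply: mulr_ge0; lra.
  by nra.
- by rewrite le_eqVlt; apply/predU1P; left; ring.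
Qed.

End truncation.

Lemma measurable_truncation d (T : measurableType d) (R : realType) (e k : R)
  (u : T -> R) : measurable_fun setT u -> measurable_fun setT (truncation e k u).
Proof.
move=> mu_u; apply: measurable_maxr => //; apply: measurable_funB => //.
exact: measurable_funM.
Qed.

(* The subcritical surplus [t `^ (q - p)] is bounded by its value at the level
   [k0], and [t / (t - h)] by its value at [k]. *)
Lemma growth_truncation (R : realType) (C p q k0 h k U t : R) :
  0 <= C -> 1 <= q <= p -> 1 <= k0 -> k0 <= h -> h < k -> U <= t -> 0 <= t ->
  (U <= k \/ U = t) ->
  C * (1 + t `^ (q - 1)) * Num.max (U - k) 0 <=
  2 * C * k0 `^ (q - p) * (k / (k - h)) `^ p * (Num.max (U - h) 0) `^ p.
Proof.
move=> C0 /andP[q1 qp] k01 k0h hk Ut t0 Ukt.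
have [Uk|kU] := leP U k.
  rewrite (max_r (_ : U - k <= 0)) ?subr_le0// mulr0.
  by rewrite !mulr_ge0 ?powR_ge0.
have {Ukt} tU : t = U by case: Ukt => [?|->//]; exfalso; lra.
rewrite tU (max_l (_ : 0 <= U - k)) ?(max_l (_ : 0 <= U - h)); try lra.
have U0 : 0 < U by lra.
have powq : 1 <= U `^ (q - 1).
  by rewrite -[leLHS](powRr0 U) ler_powR//; lra.
apply: (@le_trans _ _ (2 * C * U `^ (q - p) * U `^ p)).
  rewrite -mulrA -[2 * C * _ * _]mulrA -powRD ?(gt_eqF U0) ?implybT//.
  have q0 : 0 < q by lra.
  rewrite subrK -(mulr_powRB1 (ltW U0) q0) [2 * C]mulrC -[leRHS]mulrA.
  by rewrite ler_wpM2l//; nra.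
have U_qp : U `^ (q - p) <= k0 `^ (q - p).
  rewrite -(opprB p q) !powRN lef_pV2 ?posrE ?powR_gt0//; last lra.
  apply: ge0_ler_powR; rewrite ?nnegrE; lra.
have U_p : U `^ p <= (k / (k - h)) `^ p * (U - h) `^ p.
  have kh : 0 < k - h by lra.
  rewrite -powRM ?divr_ge0//; try lra.
  apply: ge0_ler_powR; rewrite ?nnegrE; try lra.
    by rewrite mulr_ge0 ?divr_ge0; lra.
  by rewrite mulrAC ler_pdivlMr//; nra.
rewrite -[leRHS]mulrA; apply: ler_pM; rewrite ?mulr_ge0 ?powR_ge0//.
by rewrite ler_wpM2l ?mulr_ge0.
Qed.

(** * Energy estimates for the truncations of a weak solution *)

Section caccioppoli.
Context {R : realType} (n : nat) (s : R).
Variables (mu : {measure set (n.-tuple R) -> \bar R}) (K : n.-tuple R -> R) (c : R).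
Hypotheses (s0 : 0 < s) (sn : 2 * s < n%:R) (leb : is_lebesgue_measure mu).
Hypotheses (c0 : 0 < c) (K0 : forall y, 0 <= K y).
Hypothesis Kc : forall y, y <> vzero -> c * vnorm y `^ (- (n%:R + 2 * s)) <= K y.
Variables (Om : set (n.-tuple R)) (f : n.-tuple R -> R -> R) (u : n.-tuple R -> R).
Variables (C q e : R).
Hypotheses (C0 : 0 <= C) (qp : 1 <= q <= crit_exp n s) (e1 : `|e| = 1).
Hypotheses (f_growth : growth mu Om f C q) (u_sol : weak_solution mu K Om f u).
Notation p := (crit_exp n s).
Notation S := (sobolev_const n s c).

Let u_meas : measurable_fun setT u. Proof. by case: u_sol => -[]. Qed.

Lemma powint_solution : powint s mu u \is a fin_num.
Proof.
rewrite ge0_fin_numE ?powint_ge0//; case: u_sol => -[_ [u2 [Eu _]]] _.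
exact: (powint_lty s0 sn leb c0 K0 Kc).
Qed.

Lemma le_powint_truncation k : 0 <= k ->
  (powint s mu (truncation e k u) <= powint s mu u)%E.
Proof.
move=> k0; apply: (le_powint mu s0 sn) => x.
by rewrite ger0_norm ?truncation_ge0// truncation_norm.
Qed.

Lemma powint_truncation k : 0 <= k -> powint s mu (truncation e k u) \is a fin_num.
Proof.
move=> k0; rewrite ge0_fin_numE ?powint_ge0//.
apply: le_lt_trans (le_powint_truncation k0) _.
by rewrite -ge0_fin_numE ?powint_ge0// powint_solution.
Qed.

(** The truncation is 1-Lipschitz in u and bounded by |u|, and for [k >= 0] it vanishes where u
    does. The outer [e] restores the sign required by [truncation_form]. *)
Lemma truncation_inX k : 0 <= k -> inX mu K Om (fun x => e * truncation e k u x).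
Proof.
move=> k0; case: u_sol => -[_ [u2 [Eu uOm]]] _.
have e2 : e ^+ 2 = 1 by rewrite -[LHS]real_normK ?num_real// e1 expr1n.
have v2 x : (e * truncation e k u x) ^+ 2 <= u x ^+ 2.
  rewrite exprMn e2 mul1r -[u x ^+ 2]real_normK ?num_real//.
  by rewrite ler_sqr ?nnegrE ?truncation_ge0// truncation_norm.
split; last split; last split.
- by apply: measurable_funM => //; exact: measurable_truncation.
- apply: le_lt_trans u2; apply: le_integral_pointwise => x; first by rewrite lee_fin sqr_ge0.
  by rewrite lee_fin.
- apply: le_lt_trans Eu; apply: (le_energy mu K0) => x y.
  by rewrite -mulrBr normrM e1 mul1r truncation_dist.
- apply: filterS uOm => x ux Omx; rewrite /truncation (ux Omx) mulr0 sub0r max_r ?mulr0//.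
  by rewrite oppr_le0.
Qed.

Lemma energy_truncation k : 0 <= k -> (energy mu K (truncation e k u) <=
  \int[mu]_(x in Om) (f x (u x) * (e * truncation e k u x))%:E)%E.
Proof.
move=> k0; rewrite -(u_sol.2 _ (truncation_inX k0)).
have form0 x y : (0 <= ((u x - u y) * (e * truncation e k u x - e * truncation e k u y) *
    K (vsub x y))%:E)%E.
  by rewrite lee_fin mulr_ge0// (le_trans _ (truncation_form _ _ _ _ e1)) ?sqr_ge0.
apply: le_integral_pointwise => x; first exact: integral_ge0.
apply: le_integral_pointwise => // y.
by rewrite lee_fin ler_wpM2r// truncation_form.
Qed.

(** The energy at level [k] is bounded below by [sobolev] and above by testing the equation;
    [growth_truncation] then replaces the integrand by a multiple of the p-th power of the
    truncation at the lower level [h]. *)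
Lemma caccioppoli k0 h k : 1 <= k0 -> k0 <= h -> h < k ->
  S * fine (powint s mu (truncation e k u)) `^ (1 - 2 * s / n%:R) <=
  2 * C * k0 `^ (q - p) * (k / (k - h)) `^ p * fine (powint s mu (truncation e h u)).
Proof.
move=> k01 k0h hk; have h0 : 0 <= h by lra.
have k_ge0 : 0 <= k by lra.
set A := 2 * C * _ * _; have A0 : 0 <= A by rewrite !mulr_ge0 ?powR_ge0.
rewrite -lee_fin [leRHS]EFinM (fineK (powint_truncation h0)).
apply: (le_trans (sobolev s0 sn leb c0 K0 Kc (measurable_truncation e k u_meas)
  (truncation_ge0 e k u) (esym (fineK (powint_truncation k_ge0))))).
apply: (le_trans (energy_truncation k_ge0)).
have mw := measurable_powint s (measurable_truncation e h u_meas).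
have w0 x : [set: n.-tuple R] x -> (0 <= (`|truncation e h u x| `^ p)%:E)%E.
  by rewrite lee_fin powR_ge0.
rewrite /powint -ge0_integralZl_EFin// [leLHS]integral_mkcond.
apply: ae_le_integral => [x|].
  by rewrite -EFinM lee_fin mulr_ge0 ?powR_ge0.
apply: filterS f_growth => x fx; rewrite patchE -EFinM.
case: ifPn => [/set_mem Omx|_]; last by rewrite lee_fin mulr_ge0 ?powR_ge0.
rewrite lee_fin (le_trans (ler_norm _))// !normrM e1 mul1r.
rewrite (ger0_norm (truncation_ge0 e k u x)) (ger0_norm (truncation_ge0 e h u x)).
apply: (@le_trans _ _ (C * (1 + `|u x| `^ (q - 1)) * truncation e k u x)).
  by rewrite ler_wpM2r ?truncation_ge0//; exact: fx.
have eu : `|u x| = `|e * u x| by rewrite normrM e1 mul1r.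
apply: growth_truncation => //; rewrite eu ?ler_norm//.
(* [growth_truncation] is used with t = |u x| and U = e * u x; these differ only when U is negative,
   hence below [k]. *)
have [eu0|eu0] := leP 0 (e * u x); first by right; rewrite ger0_norm.
by left; lra.
Qed.

End caccioppoli.

(* Here [b = 2 `^ p] comes from the dyadic levels and [r = p / 2] from the
   Sobolev inequality. *)
Lemma degiorgi_iteration (R : realType) (Y : nat -> R) (A b r theta : R) :
  0 < A -> 1 < b -> 1 < r -> 0 < theta -> (forall j, 0 <= Y j) -> Y 0 <= theta ->
  (forall j, Y j.+1 `^ r^-1 <= A * b ^+ j * Y j) ->
  A `^ r * theta `^ (r - 1) <= b `^ (- (r / (r - 1))) ->
  forall j, Y j <= theta * (b `^ (- (r / (r - 1)))) ^+ j.
Proof.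
move=> A0 b1 r1 th0 Y0 Yth Yrec small; set sigma := b `^ _ in small *.
have b0 : 0 < b by lra.
have sg0 : 0 < sigma by rewrite powR_gt0.
(* [sigma] is the fixed point of x -> (b x)^r: at this rate the decay outweighs the growth b^j and
   reproduces itself at each step. *)
have sgE : (b * sigma) `^ r = sigma.
  rewrite /sigma -[X in X * _](powRr1 (ltW b0)) -powRD ?(gt_eqF b0) ?implybT//.
  by rewrite -powRrM; congr (_ `^ _); field; rewrite lt0r_neq0//; lra.
elim=> [|j IH]; first by rewrite expr0 mulr1.
rewrite -[leLHS](powRr1 (Y0 _)) -(mulVf (lt0r_neq0 (lt_trans ltr01 r1))) powRrM.
have step : Y j.+1 `^ r^-1 <= A * theta * (b * sigma) ^+ j.
  apply: (le_trans (Yrec j)); rewrite exprMn.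
  have := ler_wpM2l (mulr_ge0 (ltW A0) (exprn_ge0 j (ltW b0))) IH.
  by move/le_trans; apply; rewrite le_eqVlt; apply/predU1P; left; ring.
apply: (@le_trans _ _ ((A * theta * (b * sigma) ^+ j) `^ r)).
  apply: ge0_ler_powR; rewrite ?nnegrE ?powR_ge0//; first lra.
  by rewrite !mulr_ge0 ?exprn_ge0 ?mulr_ge0// ltW.
have bs0 : 0 <= b * sigma by rewrite mulr_ge0// ltW.
have At0 : 0 <= A * theta by rewrite mulr_ge0// ltW.
rewrite powRM ?(exprn_ge0 _ bs0)//.
rewrite powRM ?(ltW A0) ?(ltW th0)// -(powR_mulrn _ bs0) powRAC sgE.
rewrite powR_mulrn ?(ltW sg0)// exprS mulrA ler_wpM2r ?exprn_ge0 ?(ltW sg0)//.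
rewrite -[theta `^ r](mulr_powRB1 (ltW th0)); last lra.
by rewrite mulrCA ler_wpM2l// ltW.
Qed.

Lemma powR_gt1 (R : realType) (a x : R) : 1 < a -> 0 < x -> 1 < a `^ x.
Proof.
move=> a1 x0; rewrite [ltLHS](_ : 1 = 1 `^ x); last by rewrite powR1.
by apply: gt0_ltr_powR; rewrite ?nnegrE//; lra.
Qed.

(** * De Giorgi iteration along dyadic levels *)

Section boundedness.
Context {R : realType} (n : nat) (s : R).
Variables (mu : {measure set (n.-tuple R) -> \bar R}) (K : n.-tuple R -> R) (c : R).
Hypotheses (s0 : 0 < s) (sn : 2 * s < n%:R) (leb : is_lebesgue_measure mu).
Hypotheses (c0 : 0 < c) (K0 : forall y, 0 <= K y).
Hypothesis Kc : forall y, y <> vzero -> c * vnorm y `^ (- (n%:R + 2 * s)) <= K y.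
Variables (Om : set (n.-tuple R)) (C q : R).
Hypotheses (C0 : 0 < C) (qp : 1 <= q <= crit_exp n s).
Notation p := (crit_exp n s).
Notation S := (sobolev_const n s c).

(** [2 * C / S] comes from [caccioppoli], and the power of 4 from the ratio of a level to its
    gap. *)
Definition iteration_factor : R := 2 * C / S * 4 `^ p.
(** The [sigma] of [degiorgi_iteration] for b = 2^p and r = p / 2: both the smallness bound and the
    decay rate. *)
Definition iteration_threshold : R := (2 `^ p) `^ (- (p / 2 / (p / 2 - 1))).

Lemma iteration_factor_gt0 : 0 < iteration_factor.
Proof. by rewrite !mulr_gt0 ?powR_gt0 ?invr_gt0 ?(sobolev_const_gt0 s0 sn). Qed.

Lemma iteration_threshold_gt0 : 0 < iteration_threshold.
Proof. by rewrite !powR_gt0. Qed.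

Lemma iteration_threshold_lt1 : iteration_threshold < 1.
Proof.
have p2 := crit_exp_gt2 s0 sn.
rewrite /iteration_threshold powRN invf_lt1 ?powR_gt0// powR_gt1 ?powR_gt1 ?ltr1n//.
  by lra.
by rewrite divr_gt0; lra.
Qed.

Section one_solution.
Variables (f : n.-tuple R -> R -> R) (u : n.-tuple R -> R).
Hypotheses (f_growth : growth mu Om f C q) (u_sol : weak_solution mu K Om f u).

Let u_meas : measurable_fun setT u. Proof. by case: u_sol => -[]. Qed.

(** Starting from a small mass at [k0], the masses along levels increasing to [2 * k0] decay
    geometrically; the mass at [2 * k0] lies below all of them, hence is zero. *)
Lemma truncation_vanishes e k0 theta : `|e| = 1 -> 1 <= k0 -> 0 < theta ->
  fine (powint s mu (truncation e k0 u)) <= theta ->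
  (iteration_factor * k0 `^ (q - p)) `^ (p / 2) * theta `^ (p / 2 - 1) <=
    iteration_threshold ->
  {ae mu, forall x, e * u x <= 2 * k0}.
Proof.
move=> e1 k01 th0 Yth small; have p2 := crit_exp_gt2 s0 sn.
have k0_gt0 : 0 < k0 by lra.
have S0 := sobolev_const_gt0 s0 sn c0.
pose lv j : R := k0 * (2 - 2^-1 ^+ j).
have half_gt0 j : 0 < 2^-1 ^+ j :> R by rewrite exprn_gt0 ?invr_gt0.
have half_le1 j : 2^-1 ^+ j <= 1 :> R by rewrite exprn_ile1 ?invr_ge0// invf_le1 ?ler1n.
have lv_ge j : k0 <= lv j by rewrite /lv ler_peMr ?(ltW k0_gt0)//; have := half_le1 j; lra.
have lv_le j : lv j <= 2 * k0.
  by rewrite /lv mulrC ler_wpM2r ?(ltW k0_gt0)//; have := half_gt0 j; lra.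
have lv_step j : lv j.+1 - lv j = k0 * 2^-1 ^+ j.+1 by rewrite /lv exprS; field.
have lv_ge0 j : 0 <= lv j by rewrite (le_trans _ (lv_ge j))// ltW.
pose Y j := fine (powint s mu (truncation e (lv j) u)).
have Y0 j : 0 <= Y j by rewrite fine_ge0 ?powint_ge0.
have rE : (p / 2)^-1 = 1 - 2 * s / n%:R.
  have half := crit_exp_half s0 sn.
  by apply: (mulIf (_ : p / 2 != 0)); rewrite ?half ?mulVf ?lt0r_neq0//; lra.
have Yrec j : Y j.+1 `^ (p / 2)^-1 <=
    iteration_factor * k0 `^ (q - p) * (2 `^ p) ^+ j * Y j.
  have lv_lt : lv j < lv j.+1 by rewrite -subr_gt0 lv_step mulr_gt0.
  have : S * Y j.+1 `^ (1 - 2 * s / n%:R) <=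
      2 * C * k0 `^ (q - p) * (lv j.+1 / (lv j.+1 - lv j)) `^ p * Y j.
    exact: (caccioppoli s0 sn leb c0 K0 Kc (ltW C0) qp e1 f_growth u_sol k01 (lv_ge j)).
  rewrite -rE mulrC -ler_pdivlMr// => /le_trans; apply.
  rewrite ler_pdivrMr//.
  (* The level is at most 2 k0 and the gap is k0 2^-(j+1), so their quotient is at most 4 * 2^j. *)
  have ratio : (lv j.+1 / (lv j.+1 - lv j)) `^ p <= 4 `^ p * (2 `^ p) ^+ j.
    rewrite -powR_mulrn ?powR_ge0// powRAC powR_mulrn// -powRM//.
    have p0 : 0 <= p by lra.
    have quot0 : 0 <= lv j.+1 / (lv j.+1 - lv j) by rewrite divr_ge0// subr_ge0 ltW.
    have four0 : 0 <= 4 * 2 ^+ j :> R by rewrite mulr_ge0// exprn_ge0.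
    apply: ge0_ler_powR; rewrite ?nnegrE//.
    rewrite ler_pdivrMr ?subr_gt0// lv_step (le_trans (lv_le _))//.
    rewrite exprVn le_eqVlt; apply/predU1P; left; rewrite exprS; field.
    by rewrite expf_neq0.
  apply: (@le_trans _ _ (2 * C * k0 `^ (q - p) * (4 `^ p * (2 `^ p) ^+ j) * Y j)).
    by rewrite ler_wpM2r// ler_wpM2l// !mulr_ge0 ?powR_ge0// ltW.
  rewrite le_eqVlt; apply/predU1P; left; rewrite /iteration_factor; field.
  exact: lt0r_neq0.
have Y_decay := degiorgi_iteration _ _ _ th0 Y0 _ Yrec small.
have {Y_decay}Y_decay j : Y j <= theta * iteration_threshold ^+ j.
  apply: Y_decay.
  - by rewrite mulr_gt0 ?iteration_factor_gt0 ?powR_gt0.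
  - by rewrite powR_gt1 ?ltr1n//; lra.
  - lra.
  - by rewrite /Y /lv expr0 (_ : 2 - 1 = 1) ?mulr1//; ring.
have Zfin := powint_truncation s0 sn leb c0 K0 Kc e1 u_sol (_ : 0 <= 2 * k0).
have {}Zfin : powint s mu (truncation e (2 * k0) u) \is a fin_num by apply: Zfin; lra.
set Z := powint s mu _ in Zfin.
have ZY j : fine Z <= Y j.
  have Yfin := powint_truncation s0 sn leb c0 K0 Kc e1 u_sol (lv_ge0 j).
  rewrite /Y -lee_fin [leLHS](fineK Zfin) [leRHS](fineK Yfin) /Z.
  apply: (le_powint mu s0 sn) => x; rewrite !ger0_norm ?truncation_ge0//.
  exact: truncation_le (lv_le j).
have Z0 : fine Z <= 0.
  have th1 : `|iteration_threshold| < 1.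
    by rewrite ger0_norm ?iteration_threshold_lt1// ltW ?iteration_threshold_gt0.
  have lim0 := cvg_geometric theta th1.
  rewrite -(cvg_lim (@Rhausdorff R) lim0); apply: limr_ge; first by apply/cvg_ex; exists 0.
  by apply: nearW => j; exact: le_trans (ZY j) (Y_decay j).
have {}Z0 : Z = 0%E.
  apply/eqP; rewrite -(fineK Zfin) eqe eq_le Z0 fine_ge0//.
  exact: powint_ge0.
have mw := measurable_powint s (measurable_truncation e (2 * k0) u_meas).
have := (ae_eq_integral_abs mu measurableT mw).1.
have -> : (\int[mu]_x `|(`|truncation e (2 * k0) u x| `^ p)%:E|)%E = 0%E.
  rewrite -Z0; apply: eq_integral => x _.
  by rewrite gee0_abs// lee_fin powR_ge0.
move=> /(_ erefl); apply: filterS => x /(_ I) /= [/powR_eq0_eq0/normr0_eq0].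
move=> w0; have := lexx (truncation e (2 * k0) u x); rewrite {2}w0.
by rewrite ge_max => /andP[]; rewrite subr_le0.
Qed.

End one_solution.

End boundedness.

(** Supplies the hypotheses on [K] of the preceding sections, with [c] a positive lower bound of [a]
    on the unit sphere. *)
Lemma kernelK_lower_bound (R : realType) (n : nat) (s : R)
    (mu : {measure set (n.-tuple R) -> \bar R}) (a : n.-tuple R -> R) :
  kernel_coeff mu a -> exists2 c, 0 < c & (forall y, 0 <= kernelK s a y) /\
    forall y, y <> vzero -> c * vnorm y `^ (- (n%:R + 2 * s)) <= kernelK s a y.
Proof.
move=> [_ [[c [c0 ca]] _]]; exists c => //.
have lower y : y <> vzero -> c * vnorm y `^ (- (n%:R + 2 * s)) <= kernelK s a y.
  move=> /eqP y0; rewrite /kernelK (negPf y0) ler_wpM2r ?powR_ge0//.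
  by apply: ca; apply: vnorm_normalize; exact/eqP.
split=> // y; have [->|/eqP y0] := eqVneq y vzero; first by rewrite /kernelK eqxx.
by apply: le_trans (lower _ y0); rewrite mulr_ge0 ?powR_ge0 ?ltW.
Qed.

(** * Choice of the starting level *)

Section truncation_tail.
Context {R : realType} (n : nat) (s : R) (mu : {measure set (n.-tuple R) -> \bar R}).
Hypotheses (s0 : 0 < s) (sn : 2 * s < n%:R).
Notation p := (crit_exp n s).

(** Dominated convergence: the truncations tend to 0 pointwise as the level grows. There is no rate,
    so the level depends on u and not just on its norm. *)
Lemma powint_truncation_small (u : n.-tuple R -> R) (e theta : R) :
  measurable_fun setT u -> powint s mu u \is a fin_num -> `|e| = 1 -> 0 < theta ->
  exists2 k0, 1 <= k0 & fine (powint s mu (truncation e k0 u)) <= theta.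
Proof.
move=> u_meas u_fin e1 th0; have p2 := crit_exp_gt2 s0 sn.
(* Levels [m.+1] rather than [m], so that the one selected is at least 1. *)
pose F m x := (`|truncation e m.+1%:R u x| `^ p)%:E.
have F_cvg x : [set: n.-tuple R] x -> F m x @[m --> \oo] --> 0%E.
  move=> _; apply: cvg_near_cst; near=> m; rewrite /F /truncation max_r.
    by rewrite normr0 powR0// lt0r_neq0//; lra.
  rewrite subr_le0 (le_trans (ler_norm _))// normrM e1 mul1r ltW//.
  apply: (lt_le_trans (archi_boundP (normr_ge0 (u x)))); rewrite ler_nat.
  by apply: leqW; near: m; exact: nbhs_infty_ge.
have G_int : mu.-integrable setT (fun x => (`|u x| `^ p)%:E).
  apply/integrableP; split; first exact: measurable_powint.
  rewrite (eq_integral (fun x => (`|u x| `^ p)%:E)).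
    by rewrite -ge0_fin_numE//; exact: powint_ge0.
  by move=> x _; rewrite gee0_abs// lee_fin powR_ge0.
have F_le m x : [set: n.-tuple R] x -> (`|F m x| <= (`|u x| `^ p)%:E)%E.
  move=> _; rewrite gee0_abs ?lee_fin ?powR_ge0//.
  have p0 : 0 <= p by lra.
  apply: ge0_ler_powR; rewrite ?nnegrE//.
  by rewrite ger0_norm ?truncation_ge0// truncation_norm.
have F_meas m : measurable_fun setT (F m).
  by apply: measurable_powint; exact: measurable_truncation.
have : (\int[mu]_x F m x)%E @[m --> \oo] --> (\int[mu]_x (cst 0 x))%E.
  exact: (dominated_cvg measurableT F_meas F_cvg _ G_int F_le).
rewrite integral0 => /fine_cvg /cvgr_lt /(_ _ th0) [m _ small].
by exists m.+1%:R; [rewrite ler1n|apply/ltW/small => /=].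
Unshelve. all: by end_near.
Qed.

(** The mass is taken over the whole space and the norm over [Om]; the integrals agree because u
    vanishes a.e. outside [Om]. *)
Lemma powint_le_Lp_norm (Om : set (n.-tuple R)) (u : n.-tuple R -> R) :
  {ae mu, forall x, ~ Om x -> u x = 0} -> powint s mu u \is a fin_num ->
  fine (powint s mu u) <= Lp_norm mu Om p u `^ p.
Proof.
move=> uOm u_fin; have p2 := crit_exp_gt2 s0 sn.
have pos x : (0 <= ((fun y => (`|u y| `^ p)%:E) \_ Om) x)%E.
  by rewrite patchE; case: ifP => // _; rewrite lee_fin powR_ge0.
have le1 : (powint s mu u <= \int[mu]_(x in Om) (`|u x| `^ p)%:E)%E.
  rewrite [leRHS]integral_mkcond; apply: ae_le_integral => //.
  apply: filterS uOm => x ux; rewrite patchE; case: ifPn => // /negP xOm.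
  rewrite ux; last by move=> ?; apply: xOm; exact: mem_set.
  by rewrite normr0 powR0// lt0r_neq0//; lra.
have le2 : (\int[mu]_(x in Om) (`|u x| `^ p)%:E <= powint s mu u)%E.
  rewrite [leLHS]integral_mkcond; apply: le_integral_pointwise => x.
    by rewrite lee_fin powR_ge0.
  by rewrite patchE; case: ifP => // _; rewrite lee_fin powR_ge0.
rewrite /Lp_norm; have <- : powint s mu u = (\int[mu]_(x in Om) (`|u x| `^ p)%:E)%E.
  by apply/eqP; rewrite eq_le le1 le2.
rewrite -powRrM mulVf ?powRr1// ?fine_ge0 ?powint_ge0//.
by rewrite lt0r_neq0//; lra.
Qed.

End truncation_tail.

(** The chosen mass gives equality at [k0 = 1], and [d <= 0] covers all higher levels. It does not
    depend on [k0], which makes the critical case [d = 0] accessible. *)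
Lemma threshold_at_fixed_mass (R : realType) (A sigma r d k0 : R) :
  0 < A -> 0 < sigma -> 1 < r -> d <= 0 -> 1 <= k0 ->
  (A * k0 `^ d) `^ r * ((sigma / A `^ r) `^ (r - 1)^-1) `^ (r - 1) <= sigma.
Proof.
move=> A0 sg0 r1 d0 k01; have Ar0 : 0 < A `^ r by rewrite powR_gt0.
rewrite -[X in _ * X]powRrM mulVf; last by rewrite lt0r_neq0//; lra.
rewrite powRr1; last by rewrite divr_ge0 ?ltW.
rewrite mulrA ler_pdivrMr// mulrC ler_wpM2l ?(ltW sg0)//.
have kd : k0 `^ d <= 1 by rewrite -(powRr0 k0) ler_powR.
apply: ge0_ler_powR; rewrite ?nnegrE ?mulr_ge0 ?powR_ge0 ?(ltW A0)//; first lra.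
by rewrite ler_piMr// ltW.
Qed.

(* A level growing polynomially with the mass [N] meets the smallness condition,
   because subcriticality makes the exponent [d = q - p] of the level negative. *)
Lemma threshold_at_growing_level (R : realType) (A sigma p r d N : R) (m : nat) :
  0 < A -> 0 < sigma -> 1 < r -> d < 0 -> 0 <= N ->
  p * (r - 1) / (- d * r) <= m%:R ->
  (A * (Num.max 1 ((A `^ r / sigma) `^ (- d * r)^-1) * (1 + N) ^+ m) `^ d) `^ r *
    ((1 + N) `^ p) `^ (r - 1) <= sigma.
Proof.
move=> A0 sg0 r1 d0 N0 hm; set G := Num.max 1 _; set e := - d * r in hm *.
have e0 : 0 < e by rewrite mulr_gt0//; lra.
have G1 : 1 <= G by rewrite le_max lexx.
have N1 : 1 <= 1 + N by lra.
have G0 : 0 <= G by lra.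
have N10 : 0 <= 1 + N by lra.
have k0 : 0 < G * (1 + N) ^+ m by rewrite mulr_gt0 ?exprn_gt0//; lra.
have q0 : 0 <= A `^ r / sigma by rewrite divr_ge0 ?powR_ge0 ?ltW.
rewrite powRM ?powR_ge0 ?(ltW A0)// -powRrM (_ : d * r = - e); last by rewrite /e; ring.
rewrite powRN mulrAC ler_pdivrMr ?powR_gt0// -powRrM.
rewrite powRM ?exprn_ge0// -powR_mulrn// -powRrM.
(* [G] absorbs the constants; the power [m] of 1 + N absorbs the mass, by [hm]. *)
have Ge : A `^ r <= sigma * G `^ e.
  rewrite mulrC -ler_pdivrMr//.
  rewrite -[leLHS](powRr1 q0) -(mulVf (lt0r_neq0 e0)) powRrM.
  by apply: ge0_ler_powR; rewrite ?nnegrE ?powR_ge0 ?(ltW e0)// le_max lexx orbT.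
rewrite mulrA; apply: ler_pM; rewrite ?powR_ge0//.
by apply: ler_powR => //; rewrite -ler_pdivrMr.
Qed.

(** * Boundedness of weak solutions and the uniform bound *)

Theorem theorem4p1 (R : realType) (n : nat) (s : R)
    (mu : {measure set (n.-tuple R) -> \bar R})
    (Om : set (n.-tuple R)) (a : n.-tuple R -> R) (C q : R) :
  0 < s < 1 -> 2 * s < n%:R ->
  is_lebesgue_measure mu ->
  domain Om -> euclid_bounded Om -> C11_boundary Om ->
  kernel_coeff mu a ->
  0 < C -> 1 <= q <= crit_exp n s ->
  (forall (f : n.-tuple R -> R -> R) (u : n.-tuple R -> R),
      caratheodory mu Om f -> growth mu Om f C q ->
      weak_solution mu (kernelK s a) Om f u ->
      in_Linfty mu Om u) /\
  (q < crit_exp n s ->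
     exists M : R -> R,
       {within [set x : R | 0 <= x], continuous M} /\
       forall (f : n.-tuple R -> R -> R) (u : n.-tuple R -> R),
         caratheodory mu Om f -> growth mu Om f C q ->
         weak_solution mu (kernelK s a) Om f u ->
         {ae mu, forall x, Om x ->
            `|u x| <= M (Lp_norm mu Om (crit_exp n s) u)}).
Proof.
move=> /andP[s0 _] sn leb _ _ _ ker C0 qp.
have [c c0 [K0 Kc]] := kernelK_lower_bound s ker.
have p2 := crit_exp_gt2 s0 sn; set p := crit_exp n s in qp p2 *.
have r1 : 1 < p / 2 by lra.
have A0 := iteration_factor_gt0 s0 sn c0 C0.
have sg0 := iteration_threshold_gt0 n s.
set A := iteration_factor _ _ _ _ in A0; set sg := iteration_threshold _ _ in sg0.
have two_sided u (B B' : R) : {ae mu, forall x, 1 * u x <= B} ->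
    {ae mu, forall x, -1 * u x <= B'} ->
    {ae mu, forall x, Om x -> `|u x| <= Num.max B B'}.
  apply: filterS2 => x; rewrite mul1r mulN1r => uB uB' _.
  by rewrite ler_norml lerNl !le_max uB uB' orbT.
have norm1 : `|1| = 1 :> R by rewrite normr1.
have normN1 : `|-1| = 1 :> R by rewrite normrN1.
split=> [f u _ fg us|qp'].
  have u_fin := powint_solution s0 sn leb c0 K0 Kc us.
  (* Fixed before the level, so that a level with mass at most [theta] can then be selected. *)
  pose theta := (sg / A `^ (p / 2)) `^ (p / 2 - 1)^-1.
  have th0 : 0 < theta by rewrite powR_gt0 ?divr_gt0 ?powR_gt0.
  have bounded e : `|e| = 1 -> exists B, {ae mu, forall x, e * u x <= B}.
    move=> e1; have [k0 k01 small] :=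
      powint_truncation_small s0 sn us.1.1 u_fin e1 th0.
    exists (2 * k0).
    apply: (truncation_vanishes s0 sn leb c0 K0 Kc C0 qp fg us e1 k01 th0 small).
    by apply: threshold_at_fixed_mass; rewrite ?subr_le0//; case/andP: qp.
  have [B uB] := bounded 1 norm1; have [B' uB'] := bounded (-1) normN1.
  by exists (Num.max B B'); exact: two_sided.
have d0 : q - p < 0 by rewrite subr_lt0.
(* Rounding the exponent up to an integer makes [M] a polynomial. *)
pose m := Num.bound (p * (p / 2 - 1) / (- (q - p) * (p / 2))).
have hm : p * (p / 2 - 1) / (- (q - p) * (p / 2)) <= m%:R.
  apply/ltW/archi_boundP; rewrite divr_ge0// mulr_ge0//; lra.
pose G := Num.max 1 ((A `^ (p / 2) / sg) `^ (- (q - p) * (p / 2))^-1).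
have G1 : 1 <= G by rewrite le_max lexx.
(* Twice the starting level, as in [truncation_vanishes]; [G] and [m] are fixed before f and u. *)
exists (fun N => 2 * (G * (1 + N) ^+ m)); split.
  apply: continuous_subspaceT => N.
  apply: cvgM; first exact: cvg_cst.
  apply: cvgM; first exact: cvg_cst.
  apply: (continuous_comp (f := fun x : R => 1 + x) (g := fun x : R => x ^+ m)).
    by apply: cvgD; [exact: cvg_cst|exact: cvg_id].
  exact: exprn_continuous.
move=> f u _ fg us; set N := Lp_norm _ _ _ _.
have N0 : 0 <= N by rewrite powR_ge0.
have u_fin := powint_solution s0 sn leb c0 K0 Kc us.
have th0 : 0 < (1 + N) `^ p by rewrite powR_gt0//; lra.
have k01 : 1 <= G * (1 + N) ^+ m.
  by rewrite mulr_ege1// exprn_ege1//; lra.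
have k00 : 0 <= G * (1 + N) ^+ m by lra.
have bounded e : `|e| = 1 -> {ae mu, forall x, e * u x <= 2 * (G * (1 + N) ^+ m)}.
  move=> e1.
  apply: (truncation_vanishes s0 sn leb c0 K0 Kc C0 qp fg us e1 k01 th0); last first.
    by apply: threshold_at_growing_level.
  have us_zero := us.1.2.2.2.
  apply: (@le_trans _ _ (fine (powint s mu u))).
    rewrite -lee_fin !fineK//.
      exact: (le_powint_truncation mu s0 sn u e1 k00).
    exact: (powint_truncation s0 sn leb c0 K0 Kc e1 us k00).
  apply: (le_trans (powint_le_Lp_norm s0 sn us_zero u_fin)).
  apply: ge0_ler_powR; rewrite ?nnegrE ?lerDr ?addr_ge0//.
  exact: le_trans (ltW p2).
by have := two_sided u _ _ (bounded 1 norm1) (bounded (-1) normN1); rewrite maxxx.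
Qed.
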